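(* Let $L$ be a discrete Lagrangian on $M\times M$ which is reversible with $S=\mathrm{id}$, i.e. $L(x,y)=L(y,x)$. Let $\mathbf{x}=(x_1,\dots,x_k,x_{k-1},\dots,x_2)$ be a reversible periodic trajectory of type $2$ (of period $n=2k-2$) such that $(x_1,\dots,x_k)$ is a nondegenerate minimum point of the functional $\mathscr{A}_+$. Then $h_\rho$ is positive definite for all $\rho\in S^1=\{\rho\in\mathbb{C}:|\rho|=1\}$. Hence $\mathbf{x}$ is hyperbolic (there are no multipliers on the unit circle).
   Context: $M$ is an $m$-dimensional manifold, $L$ a smooth function on $M\times M$ with $B(x,y)=-\partial_1\partial_2L(x,y):T_xM\to T_y^*M$ nondegenerate (it suffices near the trajectory). The discrete Lagrangian system is the locally defined map $T(x,y)=(y,z)$, $\partial_2L(x,y)+\partial_1L(y,z)=0$; an $n$-periodic trajectory is $(x_i)_{i\in\mathbb{Z}}$, $x_{i+n}=x_i$, with $\partial_2L(x_{i-1},x_i)+\partial_1L(x_i,x_{i+1})=0$ for all $i$. For trajectories of type 2 with $S=\mathrm{id}$, $\mathscr{A}_+$ is the restriction of the action $\sum_{i=1}^nL(x_i,x_{i+1})$ to sequences of the form $(x_1,\dots,x_k,x_{k-1},\dots,x_2)$; it is the function $2\sum_{i=1}^{k-1}L(x_i,x_{i+1})$ of $(x_1,\dots,x_k)\in M^k$. Nondegenerate minimum means a critical point with positive definite Hessian. Put $E_j=T_{x_j}M$ (complexified), $A_j=\partial_{22}L(x_{j-1},x_j)+\partial_{11}L(x_j,x_{j+1})$, $B_j=B(x_j,x_{j+1})$.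 For $\rho\in S^1$, $h_\rho$ is the Hermitian form on sequences $(u_j)_{j\in\mathbb{Z}}$, $u_j\in E_j$, $u_{j+n}=\rho u_j$: $$h_\rho(\mathbf{u},\overline{\mathbf{v}})=\sum_{j=1}^n\bigl(\langle A_ju_j,\bar v_j\rangle-\langle B_{j-1}u_{j-1},\bar v_j\rangle-\langle B_j^*u_{j+1},\bar v_j\rangle\bigr).$$ Multipliers are the eigenvalues of $D(T^n)(x_1,x_2)$. *)

(* Defs.v *)
From HB Require Import structures.
From mathcomp Require Import all_boot all_order all_algebra.
From mathcomp Require Import complex.
From mathcomp Require Import all_classical all_reals all_analysis.
From mathcomp Require Import zify.

Set Implicit Arguments.
Unset Strict Implicit.
Unset Printing Implicit Defensive.

Import Order.TTheory GRing.Theory Num.Theory.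
Import numFieldNormedType.Exports.

Local Open Scope classical_set_scope.
Local Open Scope ring_scope.

(** * Smooth functions and smooth manifolds *)

(* For open U this is C^oo: every iterated directional derivative exists on U
   and is differentiable (hence continuous) there. *)
Definition smooth_on (R : realType) (V W : normedModType R) (U : set V)
    (f : V -> W) : Prop :=
  forall (vs : seq V) (x : V), U x ->
    differentiable (foldr (fun v (g : V -> W) => 'D_v g) f vs) x.

(* A homeomorphism from an open subset of M onto an open subset of R^m. Both
   chart_fun and chart_inv are total functions, meaningful only on
   chart_dom and chart_img respectively. *)
Record chart (R : realType) (m : nat) (M : topologicalType) := Chart {
  chart_dom : set M;
  chart_fun :> M -> 'rV[R]_m;
  chart_inv : 'rV[R]_m -> M;
  chart_img := chart_fun @` chart_dom;
  chart_dom_open : open chart_dom;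
  chart_img_open : open chart_img;
  chart_funK : forall x, chart_dom x -> chart_inv (chart_fun x) = x;
  chart_fun_continuous : {within chart_dom, continuous chart_fun};
  chart_inv_continuous : {within chart_img, continuous chart_inv} }.

(* chart_at x is a distinguished chart around x. It serves only to identify
   T_x M with R^m; since it is an arbitrary choice, a theorem quantifying over
   all smoothManifold's covers every choice of coordinates. *)
Record smoothManifold (R : realType) (m : nat) := SmoothManifold {
  manifold_sort :> topologicalType;
  manifold_hausdorff : hausdorff_space manifold_sort;
  manifold_second_countable : @second_countable manifold_sort;
  atlas : set (chart R m manifold_sort);
  atlas_compatible : forall c d, atlas c -> atlas d ->
    smooth_on (c @` (chart_dom c `&` chart_dom d)) (d \o chart_inv c);
  chart_at : manifold_sort -> chart R m manifold_sort;
  chart_at_atlas : forall x, atlas (chart_at x);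
  chart_at_dom : forall x, chart_dom (chart_at x) x }.

Section Manifold.
Variables (R : realType) (m : nat) (M : smoothManifold R m).
Implicit Types (x y : M) (p q : M * M) (f : M -> R) (T : M * M -> M * M).

Definition coord x : 'rV[R]_m := chart_at x x.

Definition coord_inv x : 'rV[R]_m -> M := chart_inv (chart_at x).

(* the differential of f at x, an element of T_x^* M *)
Definition grad f x : 'rV[R]_m :=
  \row_a 'D_(delta_mx 0 a) (f \o coord_inv x) (coord x).

Definition hess f x : 'M[R]_m :=
  \matrix_(a, b)
    'D_(delta_mx 0 a) ('D_(delta_mx 0 b) (f \o coord_inv x)) (coord x).

(* coordinates on M x M near p *)
Definition coord2 p q : 'rV[R]_(m + m) :=
  row_mx (chart_at p.1 q.1) (chart_at p.2 q.2).

Definition coord2_inv p (w : 'rV[R]_(m + m)) : M * M :=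
  (coord_inv p.1 (lsubmx w), coord_inv p.2 (rsubmx w)).

Definition in_coord2 T p : 'rV[R]_(m + m) -> 'rV[R]_(m + m) :=
  coord2 (T p) \o T \o coord2_inv p.

(* Continuity at p ensures that T maps a neighbourhood of p into the domain of
   the chart at T p, where the coordinate expression is meaningful. *)
Definition mdifferentiable T p : Prop :=
  {for p, continuous T} /\ differentiable (in_coord2 T p) (coord2 p p).

(* DT(p), acting on row vectors by right multiplication *)
Definition mjacobian T p : 'M[R]_(m + m) := 'J (in_coord2 T p) (coord2 p p).

(* coordinates on M^k near (xs i)_i : row i of the matrix is the i-th point *)
Definition coordk k (xs : 'I_k -> M) : 'M[R]_(k, m) :=
  \matrix_(i, a) coord (xs i) 0 a.

Definition coordk_inv k (xs : 'I_k -> M) (w : 'M[R]_(k, m)) : 'I_k -> M :=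
  fun i => coord_inv (xs i) (row i w).

Definition nondegenerate_min k (F : ('I_k -> M) -> R) (xs : 'I_k -> M) : Prop :=
  let f := F \o coordk_inv xs in
  (forall v, 'D_v f (coordk xs) = 0) /\
  (forall v, v != 0 -> 0 < 'D_v ('D_v f) (coordk xs)).

End Manifold.

(** * Discrete Lagrangian systems *)

Section Lagrangian.
Variables (R : realType) (m : nat) (M : smoothManifold R m).
Variable L : M -> M -> R.
Implicit Types (x y : M) (z : int -> M).

Definition smooth_lagrangian : Prop :=
  forall c d, atlas c -> atlas d ->
    smooth_on
      [set w : 'rV[R]_(m + m) |
        chart_img c (lsubmx w) /\ chart_img d (rsubmx w)]
      (fun w : 'rV[R]_(m + m) =>
        L (chart_inv c (lsubmx w)) (chart_inv d (rsubmx w)) : R^o).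

Definition d1 x y : 'rV[R]_m := grad (fun s => L s y) x.
Definition d2 x y : 'rV[R]_m := grad (L x) y.
Definition d11 x y : 'M[R]_m := hess (fun s => L s y) x.
Definition d22 x y : 'M[R]_m := hess (L x) y.

(* Matrix of the bilinear form (u, v) |-> <B(x,y) u, v> on T_x M x T_y M: with
   row vectors, the covector B(x,y) u is u *m Bmx x y, and for v in T_y M the
   covector B(x,y)^* v is v *m (Bmx x y)^T. *)
Definition Bmx x y : 'M[R]_m :=
  \matrix_(a, b)
    - 'D_(delta_mx 0 a)
        (fun s : 'rV[R]_m => d2 (coord_inv x s) y 0 b : R^o) (coord x).

Definition nondegenerate_near z : Prop :=
  forall i : int, \forall p \near (z i, z (i + 1)), Bmx p.1 p.2 \in unitmx.

Definition periodic_trajectory (n : nat) z : Prop :=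
  (forall i : int, z (i + n%:Z) = z i) /\
  (forall i : int, d2 (z (i - 1)) (z i) + d1 (z i) (z (i + 1)) = 0).

Definition action (n : nat) z : R :=
  \sum_(1 <= i < n.+1) L (z i%:Z) (z (i%:Z + 1)).

(** ** The form h_rho *)

Definition Amx z (j : int) : 'M[R]_m :=
  d22 (z (j - 1)) (z j) + d11 (z j) (z (j + 1)).

Definition complexify (p q : nat) (A : 'M[R]_(p, q)) : 'M[R[i]]_(p, q) :=
  map_mx (real_complex R) A.

(* <xi, bar v> for a covector xi *)
Definition pairing_conj (xi v : 'rV[R[i]]_m) : R[i] :=
  (xi *m (map_mx conjc v)^T) 0 0.

(* h(u, bar v); it depends on rho only through its domain, quasi_periodic *)
Definition hform (n : nat) z (u v : int -> 'rV[R[i]]_m) : R[i] :=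
  \sum_(1 <= j < n.+1)
    (pairing_conj (u j%:Z *m complexify (Amx z j%:Z)) (v j%:Z)
     - pairing_conj
         (u (j%:Z - 1) *m complexify (Bmx (z (j%:Z - 1)) (z j%:Z))) (v j%:Z)
     - pairing_conj
         (u (j%:Z + 1) *m complexify (Bmx (z j%:Z) (z (j%:Z + 1)))^T) (v j%:Z)).

Definition quasi_periodic (n : nat) (rho : R[i]) (u : int -> 'rV[R[i]]_m) :
    Prop :=
  forall j : int, u (j + n%:Z) = rho *: u j.

Definition hform_posdef (n : nat) z (rho : R[i]) : Prop :=
  forall u, quasi_periodic n rho u -> (exists j, u j != 0) -> 0 < hform n z u u.

(** ** The map T and hyperbolicity *)

(* T is a branch, near p, of the map (x, y) |-> (y, z) determined by
   d2 L (x, y) + d1 L (y, z) = 0, with T p = q. Where Bmx is invertible such a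
   branch exists and its germ is unique, by the implicit function theorem. *)
Definition lagrangian_map_near (T : M * M -> M * M) (p q : M * M) : Prop :=
  [/\ T p = q, mdifferentiable T p &
      \forall r \near p, (T r).1 = r.2 /\ d2 r.1 r.2 + d1 r.2 (T r).2 = 0].

(* T_n \o ... \o T_1 *)
Fixpoint iterate (T : nat -> M * M -> M * M) (n : nat) : M * M -> M * M :=
  if n is n'.+1 then T n \o iterate T n' else id.

(* T^n near (z_1, z_2) is the composition of the branches T i of the map near
   (z_i, z_(i+1)), i = 1, ..., n; the multipliers are the complex eigenvalues of
   its differential at (z_1, z_2). *)
Definition hyperbolic (n : nat) z : Prop :=
  forall T : nat -> M * M -> M * M,
    (forall i : nat, (1 <= i <= n)%N ->
       lagrangian_map_near (T i) (z i%:Z, z (i%:Z + 1))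
                                 (z (i%:Z + 1), z (i%:Z + 2))) ->
    forall lambda : R[i],
      eigenvalue (complexify (mjacobian (iterate T n) (z 1, z 2))) lambda ->
      `|lambda| != 1.

End Lagrangian.

(** * Reversible trajectories of type 2, for S = id *)

(* With n = 2k - 2, the 0-based position of the j-th term of the n-periodic
   extension of (x_1, ..., x_k, x_(k-1), ..., x_2) in (x_1, ..., x_k):
   r |-> min(r, n - r) where r = (j - 1) mod n. *)
Definition fold_pos (k : nat) (j : int) : nat :=
  let n := (2 * k - 2)%N in
  let r := absz ((j - 1) %% n%:Z)%Z in
  minn r (n - r).

Lemma fold_pos_lt (k : nat) (j : int) : (1 < k)%N -> (fold_pos k j < k)%N.
Proof. by move=> hk; rewrite /fold_pos; lia. Qed.

Definition reversible_seq (X : Type) (k : nat) (hk : (1 < k)%N)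
    (xs : 'I_k -> X) : int -> X :=
  fun j => xs (Ordinal (fold_pos_lt j hk)).

(* the functional A_+ on M^k *)
Definition action_plus (R : realType) (m : nat) (M : smoothManifold R m)
    (L : M -> M -> R) (k : nat) (hk : (1 < k)%N) (xs : 'I_k -> M) : R :=
  action L (2 * k - 2) (reversible_seq hk xs).

(* Main.v *)
Require Import Defs.
From HB Require Import structures.
From mathcomp Require Import all_boot all_order all_algebra.
From mathcomp Require Import complex.
From mathcomp Require Import all_classical all_reals all_analysis.
From mathcomp Require Import ring lra zify.
Import Order.TTheory GRing.Theory Num.Theory.
Import numFieldNormedType.Exports.
Local Open Scope classical_set_scope.
Local Open Scope ring_scope.

Set Implicit Arguments.
Unset Strict Implicit.
Unset Printing Implicit Defensive.

(** Write z for the n-periodic trajectory, n = 2k - 2, and let H_j be the Hessian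
    of L at (z_j, z_(j+1)) in the distinguished charts. Grouping the terms of
    h_rho by edges (j, j+1) instead of vertices gives
      h_rho(u, conj u) = sum_(1 <= j <= n) <(u_j, u_(j+1)) H_j, conj (u_j, u_(j+1))>;
    the regrouping telescopes, and the boundary term vanishes because
    u_(j+n) = rho u_j with |rho| = 1 ([hform_edges]). As H_j is real and symmetric,
    each summand is its value on Re u plus its value on Im u
    ([pairing_conj_sym]), so only real sequences matter. The trajectory runs
    through the edges of (x_1, ..., x_k) forwards and then backwards, and since
    L(x, y) = L(y, x) an edge contributes the same quadratic form in both
    directions ([edge_formC]). Hence the sum over the period is Q(X) + Q(X'),
    where X' is X read backwards from the end of the period and Q is half the
    Hessian of A_+ at (x_1, ..., x_k) ([edge_form_sum], [action_plus_hessian]).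
    Nondegeneracy of the minimum makes Q positive definite, so h_rho is.

    For hyperbolicity, differentiating the equation d2 L + d1 L = 0 that defines
    T shows that DT maps (u_(j-1), u_j) to (u_j, u_(j+1)) with
    A_j u_j - B_(j-1) u_(j-1) - B_j^* u_(j+1) = 0 ([lsubmx_mjacobian],
    [mjacobian_linearized]). By the chain rule an eigenvector of D(T^n) with
    eigenvalue lambda extends to a nonzero solution u of this recurrence with
    u_(j+n) = lambda u_j, and then h(u, conj u) = 0 ([multiplier_kernel]). This
    contradicts positivity when |lambda| = 1.

    Two analytic points need care. The recurrence and the Hermitian symmetry use
    equality of mixed partial derivatives ([derive_comm]). And d2 L (x, y) is
    expressed in the chart chosen at y, which varies arbitrarily with y; the sum
    d2 L (x, y) + d1 L (y, z) is a covector at y, so its vanishing can be moved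
    to a fixed chart before differentiating ([derive_change_chart],
    [near_branch]). *)

(** * Directional derivatives and equality of mixed partials *)

Section Calculus.
Variable R : realType.

Lemma derive_affine (V W Z : normedModType R) (P l : V -> W) (f : W -> Z)
    (v a : V) :
  (forall (h : R) w a, P (h *: w + a) = h *: l w + P a) ->
  'D_v (f \o P) a = 'D_(l v) f (P a).
Proof.
move=> Pl; rewrite /derive /=.
set F := fun h : R => _; set G := fun h : R => _.
by suff -> : F = G by []; apply/funext => h; rewrite /F /G /= Pl.
Qed.

Lemma derive2_affine (V W Z : normedModType R) (P l : V -> W) (f : W -> Z)
    (u v a : V) :
  (forall (h : R) w a, P (h *: w + a) = h *: l w + P a) ->
  'D_u ('D_v (f \o P)) a = 'D_(l u) ('D_(l v) f) (P a).
Proof.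
move=> Pl; have -> : 'D_v (f \o P) = 'D_(l v) f \o P.
  by apply/funext => b; exact: derive_affine.
exact: derive_affine.
Qed.

(** The mean value theorem along the segment from y to y + h v. *)
Lemma mvt_direction (V : normedModType R) (g : V -> R^o) (y v : V) (h : R) :
  0 < h -> (forall s, 0 <= s <= h -> differentiable g (s *: v + y)) ->
  exists2 c, 0 <= c <= h & g (h *: v + y) - g y = h * 'D_v g (c *: v + y).
Proof.
move=> h0 dg.
pose P (s : R^o) : V := s *: v + y.
have Pl (k : R) (w a : R^o) : P (k *: w + a) = k *: (w *: v) + P a.
  by rewrite /P scalerDl scalerA addrA.
have dP (s : R^o) : differentiable P s.
  by apply: differentiableD => //; exact: differentiable_cst.
have dgP s : 0 <= s <= h -> differentiable (g \o P) s.
  by move=> sh; apply: differentiable_comp => //; exact: dg.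
have [||c ch] := @MVT R (g \o P) (fun s => 'D_v g (s *: v + y)) 0 h h0.
- move=> s sh; split.
    by apply: diff_derivable; apply: dgP; rewrite !ltW ?(itvP sh).
  by apply: etrans (derive_affine g (1 : R^o) s Pl) _; rewrite scale1r.
- apply: derivable_within_continuous => s sh.
  by apply: diff_derivable; apply: dgP; rewrite !(itvP sh).
rewrite /= /P scale0r add0r subr0 => ->.
by exists c; [rewrite !ltW ?(itvP ch)|rewrite mulrC].
Qed.

(** The mean value theorem in the direction u, applied to the difference
    y |-> f (y + h v) - f y, and then in the direction v, applied to 'D_u f. *)
Lemma mvt_second_difference (V : normedModType R) (f : V -> R^o) (x u v : V)
    (h d : R) :
  0 < h -> h * (`|u| + `|v|) < d ->
  (forall y, ball x d y -> differentiable f y /\ differentiable ('D_u f) y) ->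
  exists2 y, ball x d y &
    f (h *: u + (h *: v + x)) - f (h *: u + x) - (f (h *: v + x) - f x)
      = h * (h * 'D_v ('D_u f) y).
Proof.
move=> h0 hd df.
have inball s t : 0 <= s <= h -> 0 <= t <= h -> ball x d (s *: u + (t *: v + x)).
  move=> /andP[s0 sh] /andP[t0 th]; rewrite -ball_normE /=.
  rewrite distrC addrA addrK.
  apply: le_lt_trans (ler_normD _ _) _; apply: le_lt_trans hd.
  by rewrite !normrZ !ger0_norm // mulrDr lerD // ler_wpM2r.
have h0h : 0 <= h <= h by rewrite lexx ltW.
have z0h : 0 <= (0 : R) <= h by rewrite lexx ltW.
pose tv := (fun y => h *: v + y) : V -> V.
have tvl (k : R) w a : tv (k *: w + a) = k *: id w + tv a by rewrite /tv addrCA.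
have dtv y : differentiable tv y.
  by apply: differentiableD => //; exact: differentiable_cst.
pose phi : V -> R^o := (f \o tv) - f.
have e1 s : 0 <= s <= h -> differentiable (f \o tv) (s *: u + x).
  move=> sh; apply: differentiable_comp => //; apply: (df _ _).1.
  by rewrite /tv addrCA; exact: inball.
have e2 s : 0 <= s <= h -> differentiable f (s *: u + x).
  by move=> sh; apply: (df _ _).1; have := inball s 0 sh z0h; rewrite scale0r add0r.
have [s sh|a ah] := @mvt_direction _ phi x u h h0.
  by apply: differentiableB; [exact: e1|exact: e2].
rewrite /phi.
rewrite deriveB; last 2 first.
- by apply: diff_derivable; exact: e1.
- by apply: diff_derivable; exact: e2.
rewrite (derive_affine f u _ tvl) /tv.
have [s sh|b bh] := @mvt_direction _ ('D_u f) (a *: u + x) v h h0.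
  by apply: (df _ _).2; rewrite addrCA; exact: inball.
move=> -> E; exists (b *: v + (a *: u + x)).
  by rewrite addrCA; exact: inball.
by apply: etrans E; rewrite addrCA.
Qed.

(** Schwarz's theorem: by [mvt_second_difference] the symmetric second difference
    of f with small step h equals h^2 times a value of either mixed derivative
    near x, and both are continuous at x. *)
Theorem derive_comm (V : normedModType R) (f : V -> R^o) (x u v : V) :
  (\forall y \near x,
    [/\ differentiable f y, differentiable ('D_u f) y &
        differentiable ('D_v f) y]) ->
  {for x, continuous ('D_u ('D_v f))} -> {for x, continuous ('D_v ('D_u f))} ->
  'D_u ('D_v f) x = 'D_v ('D_u f) x.
Proof.
move=> df cuv cvu; apply/eqP; rewrite -subr_eq0 -normr_le0.
apply/ler_addgt0Pl => e e0; rewrite addr0.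
have e20 : 0 < e / 2 by rewrite divr_gt0.
move/cvgrPdist_lt : cuv => /(_ _ e20) cuv.
move/cvgrPdist_lt : cvu => /(_ _ e20) cvu.
have [d /= d0 dP] := (nbhs_ballP _ _).1 (filterI df (filterI cuv cvu)).
pose h := d / (`|u| + `|v| + 1) / 2.
have n0 : 0 < `|u| + `|v| + 1 by rewrite ltr_wpDl // addr_ge0.
have h0 : 0 < h by rewrite !divr_gt0.
have hd : h * (`|u| + `|v|) < d.
  have -> : d = h * (`|u| + `|v| + 1) * 2.
    by rewrite /h; field; exact: lt0r_neq0.
  rewrite -mulrA ltr_pM2l //; have : 0 <= `|u| + `|v| by rewrite addr_ge0.
  by lra.
have [y yd E1] : exists2 y, ball x d y &
    f (h *: u + (h *: v + x)) - f (h *: u + x) - (f (h *: v + x) - f x)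
      = h * (h * 'D_v ('D_u f) y).
  by apply: mvt_second_difference hd _ => // y /dP[[? ?]].
have [z zd E2] : exists2 y, ball x d y &
    f (h *: v + (h *: u + x)) - f (h *: v + x) - (f (h *: u + x) - f x)
      = h * (h * 'D_u ('D_v f) y).
  by apply: mvt_second_difference => //; [rewrite (addrC `|v|)|move=> y' /dP[[? ?]]].
have {E1 E2} E : 'D_v ('D_u f) y = 'D_u ('D_v f) z.
  apply: (mulfI (lt0r_neq0 h0)); apply: (mulfI (lt0r_neq0 h0)).
  apply: etrans (esym E1) (etrans _ E2); rewrite [h *: v + (h *: u + x)]addrCA.
  rewrite !opprB !addrA [LHS]addrAC [RHS]addrAC; congr (_ + _); exact: addrAC.
have [_ [_ c1]] := dP _ yd; have [_ [c2 _]] := dP _ zd.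
have -> : 'D_u ('D_v f) x - 'D_v ('D_u f) x =
    ('D_u ('D_v f) x - 'D_u ('D_v f) z) - ('D_v ('D_u f) x - 'D_v ('D_u f) y).
  by rewrite E opprB addrA subrK.
move: c1 c2 => /ltW c1 /ltW c2.
rewrite (splitr e); apply: le_trans (ler_normB _ _) _; exact: lerD c2 c1.
Qed.

End Calculus.

Section Hessian.
Variable R : realType.

Lemma derive_rV n (f : 'rV[R]_n -> R^o) (x v : 'rV[R]_n) :
  differentiable f x ->
  'D_v f x = \sum_a v 0 a * 'D_(delta_mx 0 a) f x.
Proof.
move=> df; rewrite deriveE // {1}(row_sum_delta v) linear_sum.
by apply: eq_bigr => a _; rewrite linearZ deriveE.
Qed.

(** The Hessian matrix of f at x. *)
Definition hessmx n (f : 'rV[R]_n -> R^o) (x : 'rV[R]_n) : 'M[R]_n :=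
  \matrix_(a, b) 'D_(delta_mx 0 a) ('D_(delta_mx 0 b) f) x.

Section SmoothHessian.
Variables (n : nat) (U : set 'rV[R]_n) (f : 'rV[R]_n -> R^o).
Hypotheses (U_open : open U) (f_smooth : smooth_on U f).

Lemma smooth_derive2 x u v : U x ->
  'D_u ('D_v f) x = (u *m hessmx f x *m v^T) 0 0.
Proof.
move=> Ux; pose g (b : 'I_n) : 'rV[R]_n -> R^o := v 0 b *: 'D_(delta_mx 0 b) f.
have df2 b : differentiable ('D_(delta_mx 0 b) f) x.
  exact: (f_smooth [:: delta_mx 0 b] Ux).
have dg b : derivable (g b) x u.
  by apply: derivableZ; apply: diff_derivable.
rewrite (@near_eq_derive _ _ _ _ (\sum_b g b)); last first.
  near=> y.
  have Uy : U y by near: y; exact: open_nbhs_nbhs.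
  rewrite derive_rV; last exact: (f_smooth [::] Uy).
  by rewrite fct_sumE.
rewrite derive_sum // mxE; apply: eq_bigr => b _.
rewrite deriveZ; last exact: diff_derivable.
rewrite derive_rV // !mxE mulrC; congr (_ * _).
by apply: eq_bigr => a _; rewrite mxE.
Unshelve. all: by end_near. Qed.

Lemma hessmx_sym x : U x -> (hessmx f x)^T = hessmx f x.
Proof.
move=> Ux; apply/matrixP => a b; rewrite !mxE; apply: derive_comm.
- near=> y.
  have Uy : U y by near: y; exact: open_nbhs_nbhs.
  by split; [exact: (f_smooth [::] Uy)|exact: (f_smooth [:: _] Uy)
    |exact: (f_smooth [:: _] Uy)].
- exact/differentiable_continuous/(f_smooth [:: _; _] Ux).
- exact/differentiable_continuous/(f_smooth [:: _; _] Ux).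
Unshelve. all: by end_near. Qed.

End SmoothHessian.
End Hessian.

Section Differentiability.
Variable R : realType.

Lemma near_eq_differentiable (V W : normedModType R) (f g : V -> W) (x : V) :
  {near x, f =1 g} -> differentiable f x -> differentiable g x.
Proof.
move=> fg df.
have E : g \o shift x = cst (g x) + 'd f x +o_ 0 id.
  (* near 0 the remainders of f and g at x are the same function *)
  apply/eqaddoP => e e0.
  have /eqaddoP /(_ e e0) H0 := diff_locally df.
  have H : \forall h \near (0 : V), `|f (h + x) - (f x + 'd f x h)| <= e * `|h|.
    exact: H0.
  have fg0 : \forall h \near 0, f (h + x) = g (h + x).
    have sh : (fun h => h + x) @ (0 : V) --> x.
      by rewrite -[X in _ --> X]add0r; apply: cvgD; [exact: cvg_id|exact: cvg_cst].
    exact: sh fg.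
  have {H0} Hg : \forall h \near (0 : V), `|g (h + x) - (g x + 'd f x h)| <= e * `|h|.
    near=> h; rewrite -(nbhs_singleton fg).
    have <- : f (h + x) = g (h + x) by near: h.
    by near: h.
  exact: Hg.
have dg : 'd g x = 'd f x :> (V -> W).
  exact: diff_unique (diff_continuous df) E.
apply/diff_locallyP; split; first by rewrite dg; exact: diff_continuous.
by rewrite dg; exact: E.
Unshelve. all: by end_near. Qed.

Lemma derive_comp (U V W : normedModType R) (f : U -> V) (g : V -> W) (x v : U) :
  differentiable f x -> differentiable g (f x) ->
  'D_v (g \o f) x = 'D_('D_v f x) g (f x).
Proof.
move=> df dg; rewrite [LHS]deriveE; last exact: differentiable_comp.
by rewrite diff_comp // [RHS]deriveE // deriveE.
Qed.

Lemma linear_mx_differentiable p q (W : normedModType R)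
    (f : {linear 'M[R]_(p, q) -> W}) x : differentiable f x.
Proof.
have -> : (f : 'M[R]_(p, q) -> W) =
    \sum_(i < p) \sum_(j < q) (fun x : 'M[R]_(p, q) => x i j *: f (delta_mx i j)).
  apply/funext => y; rewrite {1}(matrix_sum_delta y) linear_sum fct_sumE.
  apply: eq_bigr => i _; rewrite linear_sum fct_sumE.
  by apply: eq_bigr => j _; rewrite linearZ.
apply: differentiable_sum => i; apply: differentiable_sum => j.
exact/differentiableZl/differentiable_coord.
Qed.

Lemma linear_mx_continuous p q (W : normedModType R)
    (f : {linear 'M[R]_(p, q) -> W}) : continuous f.
Proof. by move=> x; exact/differentiable_continuous/linear_mx_differentiable. Qed.

Lemma derive_linear_mx p q (W : normedModType R)
    (f : {linear 'M[R]_(p, q) -> W}) x v : 'D_v f x = f v.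
Proof.
rewrite deriveE; last exact: linear_mx_differentiable.
by rewrite diff_lin //; exact: linear_mx_continuous.
Qed.

Lemma row_mxl_differentiable p q (t : 'rV[R]_q) (x : 'rV[R]_p) :
  differentiable (row_mx^~ t) x.
Proof.
have -> : row_mx^~ t = (mulmxr (row_mx 1%:M 0) : 'rV[R]_p -> 'rV[R]_(p + q))
    + cst (row_mx 0 t).
  apply/funext => s.
  by rewrite fctE /= mul_mx_row mulmx1 mulmx0 add_row_mx addr0 add0r.
apply: differentiableD; last exact: differentiable_cst.
exact: linear_mx_differentiable.
Qed.

Lemma row_mxr_differentiable p q (t : 'rV[R]_p) (x : 'rV[R]_q) :
  differentiable (row_mx t) x.
Proof.
have -> : row_mx t = (mulmxr (row_mx 0 1%:M) : 'rV[R]_q -> 'rV[R]_(p + q))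
    + cst (row_mx t 0).
  apply/funext => s.
  by rewrite fctE /= mul_mx_row mulmx1 mulmx0 add_row_mx addr0 add0r.
apply: differentiableD; last exact: differentiable_cst.
exact: linear_mx_differentiable.
Qed.

End Differentiability.

(** * Charts and changes of chart *)

Section Charts.
Variables (R : realType) (m : nat) (M : smoothManifold R m).

Lemma chart_invP (c : chart R m M) s :
  chart_img c s -> {for s, continuous (chart_inv c)}.
Proof.
have := @chart_inv_continuous _ _ _ c.
rewrite (continuous_open_subspace _ (@chart_img_open _ _ _ c)) => cc cs.
by apply: cc; rewrite inE.
Qed.

Lemma chart_inv_dom (c : chart R m M) s : chart_img c s -> chart_dom c (chart_inv c s).
Proof. by case=> x cx <-; rewrite chart_funK. Qed.

Lemma chart_invK (c : chart R m M) s : chart_img c s -> c (chart_inv c s) = s.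
Proof. by case=> x cx <-; rewrite chart_funK. Qed.

Lemma chart_img_fun (c : chart R m M) x : chart_dom c x -> chart_img c (c x).
Proof. by move=> cx; exists x. Qed.

Lemma coordK (x : M) : coord_inv x (Defs.coord x) = x.
Proof. by rewrite /coord_inv chart_funK //; exact: chart_at_dom. Qed.

Lemma coord_img (x : M) : chart_img (chart_at x) (Defs.coord x).
Proof. exact/chart_img_fun/chart_at_dom. Qed.

(** The covector grad f y, taken in the chart at y, gives the derivatives of f in
    any other chart c around y: the matrix of the change of chart depends only on
    c and y, not on f. *)
Lemma derive_change_chart (f : M -> R) (c : chart R m M) (y : M) (v : 'rV[R]_m) :
  atlas c -> chart_dom c y ->
  differentiable (f \o coord_inv y : 'rV[R]_m -> R^o) (Defs.coord y) ->
  'D_v (f \o chart_inv c) (c y)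
    = ('D_v (chart_at y \o chart_inv c) (c y) *m (grad f y)^T) 0 0.
Proof.
move=> ac cy df.
have dt : differentiable (chart_at y \o chart_inv c) (c y).
  apply: (atlas_compatible ac (chart_at_atlas y) [::]).
  by exists y => //; split => //; exact: chart_at_dom.
have ty : (chart_at y \o chart_inv c) (c y) = Defs.coord y by rewrite /= chart_funK.
have fE : {near c y, (f \o coord_inv y) \o (chart_at y \o chart_inv c)
                     =1 (f \o chart_inv c)}.
  have cc : chart_inv c @ c y --> y.
    by rewrite -[X in _ --> X](chart_funK cy); exact/chart_invP/chart_img_fun.
  have ds : \forall s \near c y, chart_dom (chart_at y) (chart_inv c s).
    apply: cc; apply: open_nbhs_nbhs; split; first exact: chart_dom_open.
    exact: chart_at_dom.
  by near=> s; rewrite /= /coord_inv chart_funK //; near: s.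
rewrite -(@near_eq_derive _ _ _ _ _ (c y) v fE) derive_comp ?ty //.
rewrite derive_rV // mxE; apply: eq_bigr => a _.
by rewrite !mxE.
Unshelve. all: by end_near. Qed.

End Charts.

(** * The Lagrangian in coordinates *)

Section LocalLagrangian.
Variables (R : realType) (m : nat) (M : smoothManifold R m) (L : M -> M -> R).
Hypothesis L_smooth : smooth_lagrangian L.
Implicit Types x y z : M.

(** L in the distinguished charts at x and y; meaningful on [locU x y]. *)
Definition locL x y (w : 'rV[R]_(m + m)) : R^o :=
  L (coord_inv x (lsubmx w)) (coord_inv y (rsubmx w)).

Definition locU x y : set 'rV[R]_(m + m) :=
  [set w | chart_img (chart_at x) (lsubmx w) /\ chart_img (chart_at y) (rsubmx w)].

(** The coordinates of the point (x, y). *)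
Definition loc0 x y : 'rV[R]_(m + m) := row_mx (Defs.coord x) (Defs.coord y).

(** The full Hessian of L at (x, y), in the order (x-coordinates, y-coordinates). *)
Definition locH x y := hessmx (locL x y) (loc0 x y).

Lemma locU_open x y : open (locU x y).
Proof.
rewrite (_ : locU x y = lsubmx @^-1` chart_img (chart_at x) `&`
                        rsubmx @^-1` chart_img (chart_at y)) //.
by apply: openI; apply: open_comp;
  [move=> ? _; exact: continuous_lsubmx|exact: chart_img_open
  |move=> ? _; exact: continuous_rsubmx|exact: chart_img_open].
Qed.

Lemma locU0 x y : locU x y (loc0 x y).
Proof. by rewrite /locU /= row_mxKl row_mxKr; split; exact: coord_img. Qed.

Lemma locL_smooth x y : smooth_on (locU x y) (locL x y).
Proof. exact: (L_smooth (chart_at_atlas x) (chart_at_atlas y)). Qed.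

Lemma row_mxl_affine (t : 'rV[R]_m) (h : R) (w a : 'rV[R]_m) :
  row_mx (h *: w + a) t = h *: row_mx w 0 + row_mx a t.
Proof. by rewrite scale_row_mx add_row_mx scaler0 add0r. Qed.

Lemma row_mxr_affine (t : 'rV[R]_m) (h : R) (w a : 'rV[R]_m) :
  row_mx t (h *: w + a) = h *: row_mx 0 w + row_mx t a.
Proof. by rewrite scale_row_mx add_row_mx scaler0 add0r. Qed.

Lemma row_mx_delta_l (a : 'I_m) :
  row_mx (delta_mx 0 a) 0 = delta_mx 0 (lshift m a) :> 'rV[R]_(m + m).
Proof.
apply/rowP => i; case: (split_ordP i) => j ->; rewrite ?row_mxEl ?row_mxEr !mxE.
  by rewrite eq_lshift.
by rewrite eq_rlshift.
Qed.

Lemma row_mx_delta_r (a : 'I_m) :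
  row_mx 0 (delta_mx 0 a) = delta_mx 0 (rshift m a) :> 'rV[R]_(m + m).
Proof.
apply/rowP => i; case: (split_ordP i) => j ->; rewrite ?row_mxEl ?row_mxEr !mxE.
  by rewrite eq_lrshift.
by rewrite eq_rshift.
Qed.

Lemma locL_row_l x y t :
  locL x y \o row_mx^~ t = (fun s => L s (coord_inv y t)) \o coord_inv x.
Proof. by apply/funext => s; rewrite /= /locL row_mxKl row_mxKr. Qed.

Lemma locL_row_r x y s :
  locL x y \o row_mx s = L (coord_inv x s) \o coord_inv y.
Proof. by apply/funext => t; rewrite /= /locL row_mxKl row_mxKr. Qed.

Lemma derive_locL_l x y s t v :
  'D_(row_mx v 0) (locL x y) (row_mx s t)
    = 'D_v ((fun s => L s (coord_inv y t)) \o coord_inv x) s.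
Proof. by rewrite -locL_row_l (derive_affine _ _ _ (row_mxl_affine t)). Qed.

Lemma derive_locL_r x y s t v :
  'D_(row_mx 0 v) (locL x y) (row_mx s t)
    = 'D_v (L (coord_inv x s) \o coord_inv y) t.
Proof. by rewrite -locL_row_r (derive_affine _ _ _ (row_mxr_affine s)). Qed.

Lemma locH_sym x y : (locH x y)^T = locH x y.
Proof. exact: hessmx_sym (@locU_open x y) (@locL_smooth x y) _ (locU0 x y). Qed.

Lemma derive2_locL x y u v :
  'D_u ('D_v (locL x y)) (loc0 x y) = (u *m locH x y *m v^T) 0 0.
Proof. exact: smooth_derive2 (@locU_open x y) (@locL_smooth x y) _ _ _ (locU0 x y). Qed.

Lemma derive2_locL_l x y u (v : 'rV[R]_m) :
  'D_u ('D_(row_mx v 0) (locL x y)) (loc0 x y)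
    = (u *m lsubmx (locH x y) *m v^T) 0 0.
Proof.
rewrite derive2_locL tr_row_mx trmx0; move: (locH x y) => H.
by rewrite -{1}(hsubmxK H) -mulmxA mul_row_col mulmx0 addr0 mulmxA.
Qed.

Lemma derive2_locL_r x y u (v : 'rV[R]_m) :
  'D_u ('D_(row_mx 0 v) (locL x y)) (loc0 x y)
    = (u *m rsubmx (locH x y) *m v^T) 0 0.
Proof.
rewrite derive2_locL tr_row_mx trmx0; move: (locH x y) => H.
by rewrite -{1}(hsubmxK H) -mulmxA mul_row_col mulmx0 add0r mulmxA.
Qed.

Lemma locHE x y :
  locH x y = block_mx (d11 L x y) (- Bmx L x y) (- (Bmx L x y)^T) (d22 L x y).
Proof.
have Hul : ulsubmx (locH x y) = d11 L x y.
  apply/matrixP => a b; rewrite !mxE -!row_mx_delta_l.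
  rewrite -(derive2_affine _ _ _ _ (row_mxl_affine (Defs.coord y))).
  by rewrite locL_row_l coordK.
have Hdr : drsubmx (locH x y) = d22 L x y.
  apply/matrixP => a b; rewrite !mxE -!row_mx_delta_r.
  rewrite -(derive2_affine _ _ _ _ (row_mxr_affine (Defs.coord x))).
  by rewrite locL_row_r coordK.
have Hur : ursubmx (locH x y) = - Bmx L x y.
  apply/matrixP => a b; rewrite !mxE opprK -row_mx_delta_r -row_mx_delta_l.
  rewrite -(derive_affine _ _ _ (row_mxl_affine (Defs.coord y))).
  rewrite (_ : _ \o _ = (fun s => d2 L (coord_inv x s) y 0 b)) //.
  apply/funext => s /=.
  by rewrite derive_locL_r /d2 /grad mxE.
have Hdl : dlsubmx (locH x y) = - (Bmx L x y)^T.
  by rewrite -locH_sym -trmx_ursub Hur linearN.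
by rewrite -Hul -Hdr -Hdl -Hur submxK.
Qed.

Lemma lsubmx_locH x y :
  lsubmx (locH x y) = col_mx (d11 L x y) (- (Bmx L x y)^T).
Proof. by rewrite locHE block_mxEh row_mxKl. Qed.

Lemma rsubmx_locH x y :
  rsubmx (locH x y) = col_mx (- Bmx L x y) (d22 L x y).
Proof. by rewrite locHE block_mxEh row_mxKr. Qed.

End LocalLagrangian.

(** * Linearization of the Lagrangian map *)

Section Linearization.
Variables (R : realType) (m : nat) (M : smoothManifold R m).
Implicit Types (x y z : M) (p : M * M).

Lemma coord2_invK p : coord2_inv p (coord2 p p) = p.
Proof. by case: p => x y; rewrite /coord2_inv row_mxKl row_mxKr !coordK. Qed.

Lemma coord2_inv_cvg p : coord2_inv p @ coord2 p p --> p.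
Proof.
have cl : {for coord2 p p, continuous (coord_inv p.1 \o lsubmx)}.
  apply: continuous_comp; first exact: continuous_lsubmx.
  by apply: chart_invP; rewrite row_mxKl; exact: coord_img.
have cr : {for coord2 p p, continuous (coord_inv p.2 \o rsubmx)}.
  apply: continuous_comp; first exact: continuous_rsubmx.
  by apply: chart_invP; rewrite row_mxKr; exact: coord_img.
rewrite -[X in _ --> X]coord2_invK; exact: cvg_pair cl cr.
Qed.

Lemma near_chart_dom x : \forall y \near x, chart_dom (chart_at x) y.
Proof.
apply: open_nbhs_nbhs; split; first exact: chart_dom_open.
exact: chart_at_dom.
Qed.

Lemma mjacobianE (T : M * M -> M * M) p v : mdifferentiable T p ->
  'D_v (in_coord2 T p) (coord2 p p) = v *m mjacobian T p.
Proof. by case=> _ dT; rewrite deriveEjacobian. Qed.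

Variable L : M -> M -> R.
Hypothesis L_smooth : smooth_lagrangian L.

Lemma slice_l_differentiable x y (c : chart R m M) : atlas c -> chart_dom c y ->
  differentiable ((fun s => L s y) \o coord_inv x : 'rV[R]_m -> R^o) (Defs.coord x).
Proof.
move=> ac cy.
pose F (w : 'rV[R]_(m + m)) : R^o :=
  L (coord_inv x (lsubmx w)) (chart_inv c (rsubmx w)).
have -> : ((fun s => L s y) \o coord_inv x : 'rV[R]_m -> R^o) = F \o row_mx^~ (c y).
  by apply/funext => s; rewrite /F /= row_mxKl row_mxKr chart_funK.
apply: differentiable_comp; first exact: row_mxl_differentiable.
apply: (L_smooth (chart_at_atlas x) ac [::]).
rewrite /= row_mxKl row_mxKr; split; first exact: coord_img.
exact: chart_img_fun.
Qed.

Lemma slice_r_differentiable x y (c : chart R m M) : atlas c -> chart_dom c x ->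
  differentiable (L x \o coord_inv y : 'rV[R]_m -> R^o) (Defs.coord y).
Proof.
move=> ac cx.
pose F (w : 'rV[R]_(m + m)) : R^o :=
  L (chart_inv c (lsubmx w)) (coord_inv y (rsubmx w)).
have -> : (L x \o coord_inv y : 'rV[R]_m -> R^o) = F \o row_mx (c x).
  by apply/funext => s; rewrite /F /= row_mxKl row_mxKr chart_funK.
apply: differentiable_comp; first exact: row_mxr_differentiable.
apply: (L_smooth ac (chart_at_atlas y) [::]).
rewrite /= row_mxKl row_mxKr; split; last exact: coord_img.
exact: chart_img_fun.
Qed.

Section Branch.
Variables (T : M * M -> M * M) (x y z : M).
Hypothesis T_branch : lagrangian_map_near L T (x, y) (y, z).

Let tau := in_coord2 T (x, y).

(** In coordinates near (x, y), the two conditions defining a branch of the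
    Lagrangian map read as conditions on derivatives of [locL] in fixed charts. *)
Lemma near_branch :
  \forall w \near coord2 (x, y) (x, y),
    lsubmx (tau w) = rsubmx w /\
    forall v, 'D_(row_mx 0 v) (locL L x y) w
              + 'D_(row_mx v 0) (locL L y z) (tau w) = 0.
Proof.
have [Tp [T_cont _] T_eq] := T_branch.
have cv := @coord2_inv_cvg (x, y).
have Tdom : \forall r \near (x, y), chart_dom (chart_at z) (T r).2.
  have Tc : T @ (x, y) --> (y, z) by rewrite -Tp; exact: T_cont.
  have c2 : (snd \o T) @ (x, y) --> z by apply: cvg_comp Tc _; exact: cvg_snd.
  exact: c2 (near_chart_dom z).
have Te := cv _ T_eq; have Td := cv _ Tdom.
have Uw : \forall w \near coord2 (x, y) (x, y), locU x y w.
  by apply: open_nbhs_nbhs; split; [exact: locU_open|exact: locU0].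
near=> w.
have [Tr1 covec] : (T (coord2_inv (x, y) w)).1 = (coord2_inv (x, y) w).2 /\
    d2 L (coord2_inv (x, y) w).1 (coord2_inv (x, y) w).2 +
    d1 L (coord2_inv (x, y) w).2 (T (coord2_inv (x, y) w)).2 = 0 by near: w.
have dz : chart_dom (chart_at z) (T (coord2_inv (x, y) w)).2 by near: w.
have [Ux Uy] : locU x y w by near: w.
have tauE : tau w = row_mx (rsubmx w) (chart_at z (T (coord2_inv (x, y) w)).2).
  by rewrite /tau /in_coord2 /= Tp /coord2 /= Tr1 /= /coord_inv chart_invK.
rewrite tauE row_mxKl; split => // v.
move: dz covec; rewrite /=; set z' := (T _).2 => dz.
set x' := coord_inv x (lsubmx w); set y' := coord_inv y (rsubmx w) => covec.
have dy : chart_dom (chart_at y) y' by exact: chart_inv_dom.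
have dx : chart_dom (chart_at x) x' by exact: chart_inv_dom.
have yE : chart_at y y' = rsubmx w by exact: chart_invK.
rewrite derive_locL_l -{1}(hsubmxK w) derive_locL_r.
rewrite -yE /coord_inv chart_funK //.
rewrite derive_change_chart //; last 2 first.
- exact: chart_at_atlas.
- exact: slice_r_differentiable (chart_at_atlas x) dx.
rewrite derive_change_chart //; last 2 first.
- exact: chart_at_atlas.
- exact: slice_l_differentiable (chart_at_atlas z) dz.
have /(congr1 (fun c : 'rV[R]_m =>
  ('D_v (chart_at y' \o chart_inv (chart_at y)) (chart_at y y') *m c^T) 0 0)) :=
  covec.
by rewrite trmx0 mulmx0 linearD mulmxDr [LHS]mxE [RHS]mxE.
Unshelve. all: by end_near. Qed.

Lemma branch_image_coord : tau (coord2 (x, y) (x, y)) = loc0 y z.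
Proof. by have [Tp _ _] := T_branch; rewrite /tau /in_coord2 /= coord2_invK Tp. Qed.

(** DT maps (v_1, v_2) to (v_2, v_3): the derivative of (T r).1 = r.2. *)
Lemma lsubmx_mjacobian (v : 'rV[R]_(m + m)) :
  lsubmx (v *m mjacobian T (x, y)) = rsubmx v.
Proof.
have [_ dT _] := T_branch.
rewrite -mjacobianE //.
have E : {near coord2 (x, y) (x, y), lsubmx \o tau =1 rsubmx}.
  by apply: filterS near_branch => w [].
have := @near_eq_derive _ _ _ _ _ (coord2 (x, y) (x, y)) v E.
rewrite derive_comp; [|exact: dT.2|exact: differentiable_lsubmx].
by rewrite !derive_linear_mx.
Qed.

(** The derivative of d2 L (x, y) + d1 L (y, z) = 0 along the graph of T. *)
Lemma mjacobian_linearized :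
  rsubmx (locH L x y) + mjacobian T (x, y) *m lsubmx (locH L y z) = 0.
Proof.
have [_ dT _] := T_branch.
apply/matrixP => a b; rewrite [RHS]mxE.
pose v : 'rV[R]_(m + m) := delta_mx 0 a; pose e : 'rV[R]_m := delta_mx 0 b.
pose f : 'rV[R]_(m + m) -> R^o := 'D_(row_mx 0 e) (locL L x y).
pose g : 'rV[R]_(m + m) -> R^o := 'D_(row_mx e 0) (locL L y z).
have df : differentiable f (coord2 (x, y) (x, y)).
  exact: (locL_smooth L_smooth [:: _] (locU0 x y)).
have dg : differentiable g (tau (coord2 (x, y) (x, y))).
  by rewrite branch_image_coord; exact: (locL_smooth L_smooth [:: _] (locU0 y z)).
have E : {near coord2 (x, y) (x, y), f + (g \o tau) =1 cst 0}.
  by apply: filterS near_branch => w [_ /(_ e)].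
have := @near_eq_derive _ _ _ _ _ (coord2 (x, y) (x, y)) v E.
rewrite derive_cst deriveD; last 2 first.
- exact: diff_derivable.
- by apply/diff_derivable/differentiable_comp => //; exact: dT.2.
rewrite derive_comp //; last exact: dT.2.
rewrite mjacobianE // branch_image_coord /f /g.
rewrite (derive2_locL_r L_smooth) (derive2_locL_l L_smooth).
move: (locH L x y) (locH L y z) (mjacobian T (x, y)) => H1 H2 J.
rewrite /v /e trmx_delta => <-.
rewrite [LHS]mxE; congr (_ + _).
  by rewrite -colE -rowE !mxE.
by rewrite -colE -[_ *m J *m _]mulmxA -rowE [RHS]mxE [RHS]mxE.
Qed.

End Branch.

End Linearization.

(** * The chain rule for iterates *)

Section Composition.
Variables (R : realType) (m : nat) (M : smoothManifold R m).
Implicit Types (p q : M * M) (S T : M * M -> M * M).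

Lemma near_coord2K p : \forall q \near p, coord2_inv p (coord2 p q) = q.
Proof.
have d1 : \forall q \near p, chart_dom (chart_at p.1) q.1.
  by case: p => x y; exact: cvg_fst (near_chart_dom x).
have d2 : \forall q \near p, chart_dom (chart_at p.2) q.2.
  by case: p d1 => x y d1; exact: cvg_snd (near_chart_dom y).
near=> q; rewrite /coord2_inv row_mxKl row_mxKr /coord_inv.
rewrite !chart_funK; first by case: (q).
  by near: q.
by near: q.
Unshelve. all: by end_near. Qed.

Lemma near_coord2_invK p : \forall w \near coord2 p p, coord2 p (coord2_inv p w) = w.
Proof.
have Uw : \forall w \near coord2 p p, locU p.1 p.2 w.
  by apply: open_nbhs_nbhs; split; [exact: locU_open|exact: locU0].
near=> w; have [Ux Uy] : locU p.1 p.2 w by near: w.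
by rewrite /coord2 /coord2_inv /coord_inv !chart_invK //= hsubmxK.
Unshelve. all: by end_near. Qed.

Lemma mdifferentiable_id p : mdifferentiable id p /\ mjacobian id p = 1%:M.
Proof.
have E : {near coord2 p p, id =1 in_coord2 id p}.
  by apply: filterS (near_coord2_invK p) => w /esym.
have did : mdifferentiable id p.
  split; first exact: cvg_id.
  by apply: near_eq_differentiable E _; exact: (@ex_diff _ _ _ _ _ id).
split=> //; apply/row_matrixP => i; rewrite !rowE -mjacobianE // mulmx1.
by rewrite -(@near_eq_derive _ _ _ _ _ _ _ E) derive_id.
Qed.

Lemma mdifferentiable_comp S T p :
  mdifferentiable S p -> mdifferentiable T (S p) ->
  mdifferentiable (T \o S) p
  /\ mjacobian (T \o S) p = mjacobian S p *m mjacobian T (S p).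
Proof.
move=> dS dT; have [Sc Sd] := dS; have [Tc Td] := dT.
have S0 : in_coord2 S p (coord2 p p) = coord2 (S p) (S p).
  by rewrite /in_coord2 /= coord2_invK.
have E : {near coord2 p p, in_coord2 T (S p) \o in_coord2 S p =1 in_coord2 (T \o S) p}.
  have Sw : S \o coord2_inv p @ coord2 p p --> S p.
    by apply: cvg_comp (@coord2_inv_cvg _ _ _ p) _; exact: Sc.
  have : \forall w \near coord2 p p,
      coord2_inv (S p) (coord2 (S p) ((S \o coord2_inv p) w))
        = (S \o coord2_inv p) w.
    exact: Sw _ (near_coord2K (S p)).
  by apply: filterS => w; rewrite /in_coord2 /= => ->.
have dTS : mdifferentiable (T \o S) p.
  split; first by apply: continuous_comp; [exact: Sc|exact: Tc].
  apply: near_eq_differentiable E _.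
  by apply: differentiable_comp; rewrite ?S0.
split; first exact: dTS.
apply/row_matrixP => i; rewrite !rowE.
move: (delta_mx 0 i) => v; rewrite mulmxA.
apply: etrans (esym (mjacobianE v dTS)) _.
apply: etrans (esym (@near_eq_derive _ _ _ _ _ _ _ E)) _.
have dT' : differentiable (in_coord2 T (S p)) (in_coord2 S p (coord2 p p)).
  by rewrite S0.
apply: etrans (derive_comp v Sd dT') _.
rewrite S0 (mjacobianE v dS); exact: mjacobianE.
Qed.

(** J 1 *m ... *m J n; as Jacobians act on row vectors, the first map comes first. *)
Definition mxprods (J : nat -> 'M[R]_(m + m)) (n : nat) : 'M[R]_(m + m) :=
  iteri n (fun i A => A *m J i.+1) 1%:M.

Lemma mjacobian_iterate (T : nat -> M * M -> M * M) (q : nat -> M * M) n :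
  (forall i, (1 <= i <= n)%N -> T i (q i) = q i.+1 /\ mdifferentiable (T i) (q i)) ->
  [/\ iterate T n (q 1%N) = q n.+1, mdifferentiable (iterate T n) (q 1%N) &
      mjacobian (iterate T n) (q 1%N) = mxprods (fun i => mjacobian (T i) (q i)) n].
Proof.
elim: n => [|n IH] Tq; first by have [? ?] := mdifferentiable_id (q 1%N); split.
have [|E d J] := IH; first by move=> i /andP[i1 ii]; apply: Tq; rewrite i1 ltnW.
have [TE Td] := Tq n.+1 (leqnn n.+1).
rewrite -E in TE Td; have [dc Jc] := mdifferentiable_comp d Td.
split; [exact: TE|exact: dc|apply: etrans Jc _].
by rewrite J E.
Qed.

End Composition.

(** * The second variation of A_+ *)

Section SecondDerivativeOfSum.
Variables (R : realType) (p q n N : nat).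
Variables (P : 'I_N -> {linear 'M[R]_(p, q) -> 'rV[R]_n}).
Variables (g : 'I_N -> 'rV[R]_n -> R^o) (U : 'I_N -> set 'rV[R]_n).
Hypotheses (U_open : forall i, open (U i)) (g_smooth : forall i, smooth_on (U i) (g i)).

Lemma derive2_sum_linear (a v : 'M[R]_(p, q)) : (forall i, U i (P i a)) ->
  'D_v ('D_v (\sum_i (g i \o P i))) a
    = \sum_i (P i v *m hessmx (g i) (P i a) *m (P i v)^T) 0 0.
Proof.
move=> Ua.
have Pl i (h : R) w b : P i (h *: w + b) = h *: P i w + P i b by exact: linearP.
have nearUi i : \forall b \near a, U i (P i b).
  have Pc : P i @ a --> P i a by exact: linear_mx_continuous.
  have Ui : nbhs (P i a) (U i) by apply: open_nbhs_nbhs; split.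
  exact: Pc Ui.
have nearU : \forall b \near a, forall i, U i (P i b) by exact: filter_forall nearUi.
have dP i b : differentiable (P i) b by exact: linear_mx_differentiable.
have E : {near a, 'D_v (\sum_i (g i \o P i)) =1 \sum_i ('D_(P i v) (g i) \o P i)}.
  near=> b; have Ub : forall i, U i (P i b) by near: b.
  rewrite derive_sum; last first.
    move=> i; apply/diff_derivable/differentiable_comp => //.
    exact: (g_smooth [::] (Ub i)).
  rewrite fct_sumE; apply: eq_bigr => i _; exact: derive_affine.
rewrite (@near_eq_derive _ _ _ _ _ _ _ E) derive_sum; last first.
  move=> i; apply/diff_derivable/differentiable_comp => //.
  exact: (g_smooth [:: _] (Ua i)).
apply: eq_bigr => i _; rewrite (derive_affine _ _ _ (Pl i)).
exact: smooth_derive2 (U_open (i := i)) (g_smooth (i := i)) _ _ _ (Ua i).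
Unshelve. all: by end_near. Qed.

End SecondDerivativeOfSum.

Section RowPair.
Variables (R : realType) (k m : nat) (i1 i2 : 'I_k).

(** The rows i1 and i2 of a matrix, side by side. *)
Definition rowpair (W : 'M[R]_(k, m)) : 'rV[R]_(m + m) :=
  row_mx (row i1 W) (row i2 W).

Fact rowpair_is_linear : linear rowpair.
Proof.
by move=> a u v; rewrite /rowpair !linearP /= scale_row_mx add_row_mx.
Qed.

HB.instance Definition _ := GRing.isLinear.Build _ _ _ _ _ rowpair_is_linear.

End RowPair.

Section ActionPlus.
Variables (R : realType) (m : nat) (M : smoothManifold R m) (L : M -> M -> R).
Hypothesis L_smooth : smooth_lagrangian L.
Variables (k : nat) (hk : (1 < k)%N) (xs : 'I_k -> M).

Let z := reversible_seq hk xs.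
Let fo (j : int) : 'I_k := Ordinal (fold_pos_lt j hk).

Lemma action_plus_hessian (v : 'M[R]_(k, m)) :
  'D_v ('D_v (action_plus L hk \o coordk_inv xs)) (coordk xs)
    = \sum_(1 <= j < (2 * k - 2).+1)
        (rowpair (fo j) (fo (j%:Z + 1)) v *m locH L (z j) (z (j%:Z + 1))
         *m (rowpair (fo j) (fo (j%:Z + 1)) v)^T) 0 0.
Proof.
set n := (2 * k - 2)%N.
pose P (i : 'I_n) : {linear 'M[R]_(k, m) -> 'rV[R]_(m + m)} :=
  rowpair (fo i.+1) (fo (i.+1%:Z + 1)).
pose g (i : 'I_n) := locL L (z i.+1) (z (i.+1%:Z + 1)).
have PE i : P i (coordk xs) = loc0 (z i.+1) (z (i.+1%:Z + 1)).
  rewrite /P /= /rowpair; congr row_mx; apply/rowP => a; by rewrite !mxE.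
have -> : action_plus L hk \o coordk_inv xs = \sum_i (g i \o P i).
  apply/funext => W; rewrite fct_sumE /= /action_plus /action big_add1 big_mkord.
  by apply: eq_bigr => i _; rewrite /g /locL /P /= row_mxKl row_mxKr.
rewrite (derive2_sum_linear (U := fun i : 'I_n => locU (z i.+1) (z (i.+1%:Z + 1)))).
- rewrite big_add1 big_mkord; apply: eq_bigr => i _.
  by rewrite PE.
- by move=> i; exact: locU_open.
- by move=> i; exact: locL_smooth.
- by move=> i; rewrite PE; exact: locU0.
Qed.

End ActionPlus.

(** * Positivity of the second variation over a period *)

Section EdgeForm.
Variables (R : realType) (m : nat) (M : smoothManifold R m) (L : M -> M -> R).
Hypothesis L_smooth : smooth_lagrangian L.
Hypothesis L_reversible : forall x y : M, L x y = L y x.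

(** The second differential of L at (x, y) evaluated on (a, b). *)
Definition edge_form (x y : M) (a b : 'rV[R]_m) : R :=
  (row_mx a b *m locH L x y *m (row_mx a b)^T) 0 0.

(** Symmetry of L: both directions of an edge carry the same quadratic form. *)
Lemma edge_formC x y a b : edge_form y x b a = edge_form x y a b.
Proof.
pose swap (w : 'rV[R]_(m + m)) := row_mx (rsubmx w) (lsubmx w).
have swapl (h : R) w c : swap (h *: w + c) = h *: swap w + swap c.
  by rewrite /swap !linearP /= scale_row_mx add_row_mx.
have LE : locL L y x = locL L x y \o swap.
  by apply/funext => w; rewrite /locL /= row_mxKl row_mxKr L_reversible.
rewrite /edge_form -(derive2_locL L_smooth) LE (derive2_affine _ _ _ _ swapl).
by rewrite /swap /loc0 !row_mxKl !row_mxKr (derive2_locL L_smooth).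
Qed.

Lemma edge_form00 x y : edge_form x y 0 0 = 0.
Proof. by rewrite /edge_form row_mx0 !mul0mx mxE. Qed.

Local Opaque edge_form.

Variables (k : nat) (hk : (1 < k)%N) (xs : 'I_k -> M).
Hypothesis x_min : nondegenerate_min (action_plus L hk) xs.

Let z := reversible_seq hk xs.
Let fo (j : int) : 'I_k := Ordinal (fold_pos_lt j hk).

(** On 1, ..., k the position is j - 1; it is invariant under j |-> 2k - j, the
    reflection of the period that fixes k. *)
Lemma fold_pos_first (j : nat) : (1 <= j <= k)%N -> fold_pos k j%:Z = j.-1.
Proof.
move=> jk; rewrite /fold_pos; have -> : (j%:Z - 1 = j.-1%:Z)%R by lia.
by rewrite modz_nat modn_small; lia.
Qed.

Lemma fold_pos_mirror (j : nat) :
  (1 <= j <= k)%N -> fold_pos k (2 * k - j)%N%:Z = fold_pos k j%:Z.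
Proof.
move=> jk; rewrite (fold_pos_first jk) /fold_pos.
have [j1|j1] := eqVneq j 1%N.
  subst j; have -> : ((2 * k - 1)%N%:Z - 1 = (2 * k - 2)%N%:Z)%R by lia.
  by rewrite modzz; lia.
have -> : ((2 * k - j)%N%:Z - 1 = (2 * k - j.+1)%N%:Z)%R by lia.
by rewrite modz_nat modn_small; lia.
Qed.

Lemma fo_mirror (j : nat) : (1 <= j <= k)%N -> fo (2 * k - j)%N%:Z = fo j%:Z.
Proof. by move=> jk; apply/val_inj/fold_pos_mirror. Qed.

(** The edge (2k - j - 1, 2k - j) of the way back is the mirror image of
    (j, j + 1). *)
Lemma sum_mirror (F : nat -> R) :
  \sum_(1 <= j < (2 * k - 2).+1) F j
    = \sum_(1 <= j < k) F j + \sum_(1 <= j < k) F (2 * k - j.+1)%N.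
Proof.
rewrite (big_cat_nat (n := k)) /=; [|lia|lia]; congr (_ + _).
rewrite big_nat_rev /=.
have {1}-> : k = (1 + k.-1)%N by lia.
rewrite big_addn; have -> : ((2 * k - 2).+1 - k.-1 = k)%N by lia.
apply: eq_big_nat => j jk; congr F; lia.
Qed.

(** The second variation of the sum of the L (x_j, x_(j+1)), 1 <= j < k, along X:
    half of that of A_+. *)
Definition half_form (X : nat -> 'rV[R]_m) : R :=
  \sum_(1 <= j < k) edge_form (z j) (z j.+1) (X j) (X j.+1).

Lemma edge_form_sum (X : nat -> 'rV[R]_m) :
  \sum_(1 <= j < (2 * k - 2).+1) edge_form (z j%:Z) (z (j%:Z + 1)) (X j) (X j.+1)
    = half_form X + half_form (fun j => X (2 * k - j)%N).
Proof.
rewrite (sum_mirror (fun j => edge_form (z j%:Z) (z (j%:Z + 1)) (X j) (X j.+1))).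
rewrite /half_form.
apply: (f_equal2 +%R).
  apply: eq_big_nat => j jk.
  by have -> : j%:Z + 1 = j.+1%:Z by lia.
apply: eq_big_nat => j jk.
have -> : (2 * k - j.+1)%N%:Z + 1 = (2 * k - j)%N%:Z by lia.
have -> : (2 * k - j.+1).+1 = (2 * k - j)%N by lia.
rewrite /z /reversible_seq -!/(fo _) !fo_mirror; [|lia|lia].
by rewrite edge_formC.
Qed.

(** The matrix v with rows X 1, ..., X k is a nonzero variation of (x_1, ..., x_k).
    Folding makes the induced periodic variation symmetric under j |-> 2k - j, so
    the Hessian of A_+ at v is twice [half_form X]. *)
Lemma half_form_gt0 (X : nat -> 'rV[R]_m) (j : nat) :
  (1 <= j <= k)%N -> X j != 0 -> 0 < half_form X.
Proof.
move=> jk Xj.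
pose v : 'M[R]_(k, m) := \matrix_(i < k) X i.+1.
have rowv (i : nat) : (1 <= i <= k)%N -> row (fo i) v = X i.
  move=> ik; rewrite rowK; congr X; rewrite /= fold_pos_first //; lia.
have v0 : v != 0.
  apply: contraNneq Xj => v0; rewrite -(rowv j) //.
  by rewrite v0 row0.
have [_ /(_ v v0)] := x_min; rewrite /= action_plus_hessian //.
rewrite (eq_bigr (fun j : nat => edge_form (z j%:Z) (z (j%:Z + 1))
   (row (fo j) v) (row (fo j.+1) v))); last first.
  by move=> i _; have -> : i%:Z + 1 = i.+1%:Z by lia.
rewrite (edge_form_sum (fun j => row (fo j) v)).
have -> : half_form (fun j => row (fo (2 * k - j)%N) v)
    = half_form (fun j => row (fo j) v).
  by apply: eq_big_nat => i ik; rewrite !fo_mirror //; lia.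
have -> : half_form (fun j => row (fo j) v) = half_form X.
  by apply: eq_big_nat => i ik; rewrite !rowv //; lia.
by lra.
Qed.

Lemma half_form_ge0 (X : nat -> 'rV[R]_m) : 0 <= half_form X.
Proof.
have [/existsP[j Xj]|] := boolP [exists j : 'I_k, X j.+1 != 0].
  by apply/ltW/(@half_form_gt0 X j.+1) => //; have := ltn_ord j; lia.
rewrite negb_exists => /forallP X0.
rewrite /half_form big_nat big1 // => j /andP[j1 jk].
have X00 (i : nat) : (1 <= i <= k)%N -> X i = 0.
  case: i => // i /andP[_ ik]; apply/eqP; rewrite -[_ == _]negbK.
  exact: (X0 (Ordinal ik)).
by rewrite !X00 ?edge_form00 //; lia.
Qed.

Lemma edge_form_sum_ge0 (X : nat -> 'rV[R]_m) :
  0 <= \sum_(1 <= j < (2 * k - 2).+1)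
         edge_form (z j%:Z) (z (j%:Z + 1)) (X j) (X j.+1).
Proof. by rewrite edge_form_sum addr_ge0 ?half_form_ge0. Qed.

Lemma edge_form_sum_gt0 (X : nat -> 'rV[R]_m) (j : nat) :
  (1 <= j <= 2 * k - 2)%N -> X j != 0 ->
  0 < \sum_(1 <= j < (2 * k - 2).+1)
         edge_form (z j%:Z) (z (j%:Z + 1)) (X j) (X j.+1).
Proof.
move=> jn Xj; rewrite edge_form_sum; have [jk|kj] := leqP j k.
  apply: ltr_wpDr; first exact: half_form_ge0.
  by apply: half_form_gt0 Xj; lia.
apply: ltr_wpDl; first exact: half_form_ge0.
apply: (@half_form_gt0 _ (2 * k - j)); first lia.
by rewrite subKn //; lia.
Qed.

End EdgeForm.

(** * Hermitian forms of real symmetric matrices *)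

Section Pairing.
Variables (R : realType).
Local Notation C := R[i].
Implicit Types n : nat.

Lemma pairing_conjDl n (a b c : 'rV[C]_n) :
  pairing_conj (a + b) c = pairing_conj a c + pairing_conj b c.
Proof. by rewrite /pairing_conj mulmxDl mxE. Qed.

Lemma pairing_conjNl n (a c : 'rV[C]_n) :
  pairing_conj (- a) c = - pairing_conj a c.
Proof. by rewrite /pairing_conj mulNmx mxE. Qed.

Lemma pairing_conj0l n (c : 'rV[C]_n) : pairing_conj 0 c = 0.
Proof. by rewrite /pairing_conj mul0mx mxE. Qed.

Lemma pairing_conj_row p q (a b : 'rV[C]_p) (c d : 'rV[C]_q) :
  pairing_conj (row_mx a c) (row_mx b d) = pairing_conj a b + pairing_conj c d.
Proof. by rewrite /pairing_conj map_row_mx tr_row_mx mul_row_col mxE. Qed.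

Lemma pairing_conjZ n (rho : C) (a b : 'rV[C]_n) : `|rho| = 1 ->
  pairing_conj (rho *: a) (rho *: b) = pairing_conj a b.
Proof.
move=> rho1; rewrite /pairing_conj -scalemxAl mxE !mxE mulr_sumr.
apply: eq_bigr => i _; rewrite !mxE rmorphM mulrCA !mulrA.
by rewrite -(mulrA (a 0 i)) -[rho * _]/(rho * rho^*) -normCK rho1 expr1n mulr1.
Qed.

(** Entrywise real and imaginary parts. *)
Definition Remx n (W : 'rV[C]_n) : 'rV[R]_n := map_mx (@complex.Re R) W.
Definition Immx n (W : 'rV[C]_n) : 'rV[R]_n := map_mx (@complex.Im R) W.

Lemma ReImmx_eq0 n (W : 'rV[C]_n) : Remx W = 0 -> Immx W = 0 -> W = 0.
Proof.
move=> /rowP re0 /rowP im0; apply/rowP => i; move: (re0 i) (im0 i).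
by rewrite !mxE; case: (W 0 i) => a b /= -> ->.
Qed.

Lemma pairing_conj_sym n (H : 'M[R]_n) (W : 'rV[C]_n) : H^T = H ->
  pairing_conj (W *m complexify H) W
    = real_complex R ((Remx W *m H *m (Remx W)^T) 0 0
                      + (Immx W *m H *m (Immx W)^T) 0 0).
Proof.
move=> Hs; set X := Remx W; set Y := Immx W.
have WE : W = complexify X + 'i%C *: complexify Y.
  by apply/rowP => i; rewrite !mxE -complexE.
have WcE : map_mx conjc W = complexify X - 'i%C *: complexify Y.
  apply/rowP => i; rewrite !mxE /=; case: (W 0 i) => a b /=.
  by simpc.
have XY : X *m H *m Y^T = (Y *m H *m X^T)^T.
  by rewrite !trmx_mul trmxK Hs mulmxA.
have cM p q r (A : 'M[R]_(p, q)) (B : 'M[R]_(q, r)) :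
  complexify (A *m B) = complexify A *m complexify B by exact: map_mxM.
have cT p q (A : 'M[R]_(p, q)) : (complexify A)^T = complexify A^T.
  by rewrite /complexify map_trmx.
rewrite /pairing_conj WcE {1}WE linearB linearZ /= !cT.
rewrite mulmxDl mulmxBr !mulmxDl -!scalemxAr -!scalemxAl scalerA -!cM XY.
move: (X *m H *m X^T) (Y *m H *m X^T) (Y *m H *m Y^T) => A D F.
rewrite -expr2 sqr_i !mxE [RHS]rmorphD /=; ring.
Qed.

End Pairing.

(** * The form h_rho as a sum over edges *)

Section HermitianForm.
Variables (R : realType) (m : nat) (M : smoothManifold R m) (L : M -> M -> R).
Hypothesis L_smooth : smooth_lagrangian L.
Local Notation C := R[i].
Variables (n : nat) (z : int -> M).
Implicit Types u : int -> 'rV[C]_m.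

(** The covector h_rho(u, .) at the vertex j: the linearized equation of motion is
    euler_lagrange u j = 0. *)
Definition euler_lagrange u (j : int) : 'rV[C]_m :=
  u j *m complexify (Amx L z j)
  - u (j - 1) *m complexify (Bmx L (z (j - 1)) (z j))
  - u (j + 1) *m complexify (Bmx L (z j) (z (j + 1)))^T.

Lemma hformE u :
  hform L n z u u
    = \sum_(1 <= j < n.+1) pairing_conj (euler_lagrange u j%:Z) (u j%:Z).
Proof.
apply: eq_bigr => j _.
by rewrite /euler_lagrange !pairing_conjDl !pairing_conjNl.
Qed.

Hypothesis z_per : forall i : int, z (i + n%:Z) = z i.

(** The variation (u_j, u_(j+1)) of the edge (z_j, z_(j+1)). *)
Definition edge u (j : int) : 'rV[C]_(m + m) := row_mx (u j) (u (j + 1)).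

Lemma complexifyD p q (A B : 'M[R]_(p, q)) :
  complexify (A + B) = complexify A + complexify B.
Proof. exact: map_mxD. Qed.

Lemma complexifyN p q (A : 'M[R]_(p, q)) :
  complexify (- A) = - complexify A.
Proof. exact: map_mxN. Qed.

Lemma pairing_edge (a b : 'rV[C]_m) (P Q S : 'M[R]_m) :
  pairing_conj (row_mx a b *m complexify (block_mx P (- Q) (- Q^T) S)) (row_mx a b)
    = pairing_conj (a *m complexify P) a - pairing_conj (b *m complexify Q^T) a
      + (pairing_conj (b *m complexify S) b - pairing_conj (a *m complexify Q) b).
Proof.
rewrite /complexify map_block_mx -!/(complexify _) mul_row_block.
rewrite pairing_conj_row !complexifyN !mulmxN !pairing_conjDl !pairing_conjNl.
by congr (_ + _); exact: addrC.
Qed.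

Lemma hform_edges (rho : C) u : `|rho| = 1 -> quasi_periodic n rho u ->
  hform L n z u u
    = \sum_(1 <= j < n.+1)
        pairing_conj (edge u j%:Z *m complexify (locH L (z j%:Z) (z (j%:Z + 1))))
                     (edge u j%:Z).
Proof.
move=> rho1 uq.
(* the part of the vertex term j that belongs to the edge (j - 1, j) *)
pose G (j : nat) : C :=
  pairing_conj (u j%:Z *m complexify (d22 L (z (j%:Z - 1)) (z j%:Z))) (u j%:Z)
  - pairing_conj (u (j%:Z - 1) *m complexify (Bmx L (z (j%:Z - 1)) (z j%:Z))) (u j%:Z).
have Gper : G n.+1 = G 1%N.
  rewrite /G; have -> : n.+1%:Z - 1 = 0 + n%:Z by lia.
  have -> : n.+1%:Z = 1 + n%:Z by lia.
  rewrite !z_per !uq -!scalemxAl !pairing_conjZ //.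
apply/eqP; rewrite eq_sym -subr_eq0 -sumrB.
rewrite (eq_bigr (fun j => G j.+1 - G j)).
  by rewrite telescope_sumr // Gper subrr.
move=> j _; rewrite /G; have -> : j.+1%:Z - 1 = j%:Z by lia.
have -> : j.+1%:Z = j%:Z + 1 by lia.
rewrite /edge (locHE L_smooth) pairing_edge /Amx complexifyD mulmxDr pairing_conjDl.
have aux (x1 x2 x3 x4 x5 x6 : C) :
  x1 - x2 + (x3 - x4) - (x5 + x1 - x6 - x2) = x3 - x4 - (x5 - x6) by ring.
exact: aux.
Qed.

Lemma euler_lagrange_quasi_periodic (rho : C) u (j : int) :
  quasi_periodic n rho u ->
  euler_lagrange u (j + n%:Z) = rho *: euler_lagrange u j.
Proof.
move=> uq; rewrite /euler_lagrange /Amx.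
have -> : j + n%:Z - 1 = (j - 1) + n%:Z by lia.
have -> : j + n%:Z + 1 = (j + 1) + n%:Z by lia.
rewrite (z_per j) (z_per (j - 1)) (z_per (j + 1)) (uq j) (uq (j - 1)) (uq (j + 1)).
by rewrite 2!scalerBr -3!scalemxAl.
Qed.

End HermitianForm.

(** * Positive definiteness of h_rho *)

Section PositiveDefiniteness.
Variables (R : realType) (m : nat).
Local Notation C := R[i].

Lemma quasi_periodic_neq0 (n : nat) (rho : C) (u : int -> 'rV[C]_m) :
  (0 < n)%N -> `|rho| = 1 -> quasi_periodic n rho u -> (exists j, u j != 0) ->
  exists2 i : nat, (1 <= i <= n)%N & u i%:Z != 0.
Proof.
move=> n0 rho1 uq [j uj].
have uqt (t : nat) i : u (i + t%:Z * n%:Z) = rho ^+ t *: u i.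
  elim: t i => [|t IH] i; first by rewrite mul0r addr0 scale1r.
  have -> : i + t.+1%:Z * n%:Z = (i + t%:Z * n%:Z) + n%:Z by lia.
  by rewrite uq IH scalerA exprS.
pose r := absz ((j - 1) %% n%:Z)%Z; pose q := ((j - 1) %/ n%:Z)%Z.
have jE : j = r.+1%:Z + q * n%:Z.
  have := divz_eq (j - 1) n%:Z; rewrite /r /q.
  have : 0 <= ((j - 1) %% n%:Z)%Z by apply: modz_ge0; lia.
  by lia.
have rn : (1 <= r.+1 <= n)%N.
  have : ((j - 1) %% n%:Z)%Z < n%:Z by apply: ltz_pmod; lia.
  have : 0 <= ((j - 1) %% n%:Z)%Z by apply: modz_ge0; lia.
  by rewrite /r; lia.
exists r.+1 => //; apply: contraNneq uj => ur; rewrite jE.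
(* u j and u r.+1 differ by a power of rho; for q < 0 go from j up to r.+1 *)
have [q0|q0] := leP 0 q.
  by rewrite -(gez0_abs q0) uqt ur scaler0.
have rho0 : rho != 0 by rewrite -normr_gt0 rho1.
have := uqt `|q|%N j; rewrite {1}jE.
have -> : r.+1%:Z + q * n%:Z + `|q|%N%:Z * n%:Z = r.+1%:Z by lia.
by rewrite ur -jE => /esym/eqP; rewrite scaler_eq0 expf_eq0 (negbTE rho0) andbF.
Qed.

Variables (M : smoothManifold R m) (L : M -> M -> R).
Hypothesis L_smooth : smooth_lagrangian L.
Hypothesis L_reversible : forall x y : M, L x y = L y x.
Variables (k : nat) (hk : (1 < k)%N) (xs : 'I_k -> M).
Hypothesis x_min : nondegenerate_min (action_plus L hk) xs.

Let z := reversible_seq hk xs.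
Let n := (2 * k - 2)%N.

Lemma hform_real (rho : C) (u : int -> 'rV[C]_m) :
  (forall i : int, z (i + n%:Z) = z i) -> `|rho| = 1 -> quasi_periodic n rho u ->
  hform L n z u u = real_complex R
    (\sum_(1 <= j < n.+1) edge_form L (z j%:Z) (z (j%:Z + 1))
        (Remx (u j%:Z)) (Remx (u j.+1%:Z))
     + \sum_(1 <= j < n.+1) edge_form L (z j%:Z) (z (j%:Z + 1))
        (Immx (u j%:Z)) (Immx (u j.+1%:Z))).
Proof.
move=> z_per rho1 uq; rewrite (hform_edges L_smooth z_per rho1 uq).
rewrite -big_split rmorph_sum; apply: eq_bigr => j _.
rewrite pairing_conj_sym; last exact: locH_sym.
rewrite /edge /Remx /Immx !map_row_mx /edge_form.
by have -> : j.+1%:Z = j%:Z + 1 by lia.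
Qed.

Lemma hform_reversible_posdef (rho : C) :
  (forall i : int, z (i + n%:Z) = z i) -> `|rho| = 1 -> hform_posdef L n z rho.
Proof.
move=> z_per rho1 u uq u0.
rewrite (hform_real z_per rho1 uq) -[0]/(real_complex R 0) ltcR.
have n0 : (0 < n)%N by rewrite /n; lia.
have [i i_n ui] := quasi_periodic_neq0 n0 rho1 uq u0.
have [re0|re0] := eqVneq (Remx (u i)) 0.
  apply: ltr_wpDl; first exact: (edge_form_sum_ge0 L_smooth L_reversible x_min
    (fun j => Remx (u j%:Z))).
  apply: (edge_form_sum_gt0 L_smooth L_reversible x_min
    (X := fun j => Immx (u j%:Z)) i_n).
  by apply: contraNneq ui => im0; apply/eqP; exact: ReImmx_eq0.
apply: ltr_wpDr; first exact: (edge_form_sum_ge0 L_smooth L_reversible x_min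
  (fun j => Immx (u j%:Z))).
exact: (edge_form_sum_gt0 L_smooth L_reversible x_min
  (X := fun j => Remx (u j%:Z)) i_n).
Qed.

End PositiveDefiniteness.

(** * Multipliers *)

Section QuasiPeriodicExtension.
Variables (R : realType) (m n : nat).
Local Notation C := R[i].
Variables (lambda : C) (U : nat -> 'rV[C]_(m + m)).
Hypothesis n0 : (0 < n)%N.
Hypothesis lambda0 : lambda != 0.
Hypothesis U_return : U n = lambda *: U 0%N.
Hypothesis U_shift : forall i, (i < n)%N -> lsubmx (U i.+1) = rsubmx (U i).

(** U i stands for the pair (u_(i+1), u_(i+2)), 0 <= i <= n; [extension] is the
    n-quasi-periodic sequence u with these pairs. *)
Definition extension (j : int) : 'rV[C]_m :=
  lambda ^ ((j - 1) %/ n%:Z)%Z *: lsubmx (U (absz ((j - 1) %% n%:Z)%Z)).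

Lemma extension_quasi_periodic : quasi_periodic n lambda extension.
Proof.
move=> j; rewrite /extension; have -> : j + n%:Z - 1 = (j - 1) + n%:Z by lia.
rewrite divzDr ?dvdzz // divzz modzDr.
have -> : (n%:Z != 0) by lia.
by rewrite expfzDr // expr1z mulrC scalerA.
Qed.

Lemma extension_nat (j : nat) :
  (1 <= j <= n.+1)%N -> extension j%:Z = lsubmx (U j.-1).
Proof.
case: j => // j /= jn; have [{}jn|nj] := ltnP j n.
  rewrite /extension; have -> : j.+1%:Z - 1 = j%:Z by lia.
  by rewrite divz_nat modz_nat modn_small // divn_small // expr0z scale1r.
have -> : j = n by lia.
have -> : n.+1%:Z = 1 + n%:Z by lia.
rewrite extension_quasi_periodic /extension subrr div0z mod0z expr0z scale1r.
by rewrite U_return linearZ.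
Qed.

Lemma edge_extension (j : nat) :
  (1 <= j <= n.+1)%N -> edge extension j%:Z = U j.-1.
Proof.
move=> jn; have [jn'|nj] := leqP j n.
  rewrite /edge; have -> : j%:Z + 1 = j.+1%:Z by lia.
  rewrite !extension_nat //=; try lia.
  case: j jn jn' => // j _ jn /=.
  by rewrite U_shift ?hsubmxK.
have -> : j = n.+1 by lia.
rewrite /edge /=; have -> : n.+1%:Z + 1 = (1 + 1) + n%:Z by lia.
have -> : n.+1%:Z = 1 + n%:Z by lia.
rewrite !extension_quasi_periodic -scale_row_mx U_return; congr (_ *: _).
rewrite !extension_nat //=.
by rewrite U_shift // hsubmxK.
Qed.

Lemma extension_neq0 : U 0%N != 0 -> exists j, extension j != 0.
Proof.
move=> v0; apply: contrapT => /forallNP u0.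
have uz j : extension j = 0 by apply/eqP; rewrite -[_ == _]negbK; apply/negP/u0.
have := @edge_extension 1%N isT; rewrite /edge !uz row_mx0 /= => v00.
by rewrite -v00 eqxx in v0.
Qed.

End QuasiPeriodicExtension.

Section Multipliers.
Variables (R : realType) (m : nat) (M : smoothManifold R m) (L : M -> M -> R).
Hypothesis L_smooth : smooth_lagrangian L.
Local Notation C := R[i].

Lemma complexifyM p q r (A : 'M[R]_(p, q)) (B : 'M[R]_(q, r)) :
  complexify (A *m B) = complexify A *m complexify B.
Proof. exact: map_mxM. Qed.

Lemma complexify0 p q : complexify (0 : 'M[R]_(p, q)) = 0.
Proof. exact: map_mx0. Qed.

Lemma mul_edges_complexify (a b c : 'rV[C]_m) (B D A B' : 'M[R]_m) :
  row_mx a b *m complexify (col_mx (- B) D)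
    + row_mx b c *m complexify (col_mx A (- B'^T))
  = b *m complexify (D + A) - a *m complexify B - c *m complexify B'^T.
Proof.
rewrite /complexify !map_col_mx -!/(complexify _) !mul_row_col !complexifyN !mulmxN.
rewrite complexifyD mulmxDr addrA; congr (_ - _).
by rewrite addrC addrA addrAC [_ + b *m complexify D]addrC.
Qed.

Lemma complexify_lsubmx p (J : 'M[R]_(p + p)) (U : 'rV[C]_(p + p)) :
  (forall v : 'rV[R]_(p + p), lsubmx (v *m J) = rsubmx v) ->
  lsubmx (U *m complexify J) = rsubmx U.
Proof.
move=> HJ; have JE : lsubmx J = rsubmx 1%:M.
  apply/row_matrixP => i; rewrite !rowE mulmx_lsub HJ.
  by rewrite mulmx_rsub mulmx1.
rewrite -mulmx_lsub /complexify -map_lsubmx JE map_rsubmx map_mx1.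
by rewrite mulmx_rsub mulmx1.
Qed.

(** Consecutive edges related by DT satisfy the linearized equation of motion at
    their common vertex. *)
Lemma branch_euler_lagrange (T : M * M -> M * M) (z : int -> M)
    (u : int -> 'rV[C]_m) (i : int) :
  lagrangian_map_near L T (z i, z (i + 1)) (z (i + 1), z (i + 2)) ->
  edge u i *m complexify (mjacobian T (z i, z (i + 1))) = edge u (i + 1) ->
  euler_lagrange L z u (i + 1) = 0.
Proof.
move=> Ti uJ; have := mjacobian_linearized L_smooth Ti.
have -> : i + 2 = i + 1 + 1 by lia.
move=> /(congr1 (fun A => edge u i *m complexify A)).
rewrite complexifyD complexifyM mulmxDr mulmxA uJ.
rewrite (rsubmx_locH L_smooth) (lsubmx_locH L_smooth).
rewrite /edge mul_edges_complexify complexify0 mulmx0 => E.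
by rewrite /euler_lagrange /Amx addrK.
Qed.

Lemma hform_euler_lagrange (n : nat) (z : int -> M) (u : int -> 'rV[C]_m) :
  (forall j : nat, (1 <= j <= n)%N -> euler_lagrange L z u j%:Z = 0) ->
  hform L n z u u = 0.
Proof.
move=> EL; rewrite hformE big_nat big1 // => j jn.
by rewrite EL // pairing_conj0l.
Qed.

Lemma mjacobian_return (n : nat) (z : int -> M) (T : nat -> M * M -> M * M) :
  (forall i : nat, (1 <= i <= n)%N ->
    lagrangian_map_near L (T i) (z i%:Z, z (i%:Z + 1)) (z (i%:Z + 1), z (i%:Z + 2))) ->
  mjacobian (iterate T n) (z 1, z 2)
    = mxprods (fun i => mjacobian (T i) (z i%:Z, z (i%:Z + 1))) n.
Proof.
move=> T_branch.
have [|_ _] := @mjacobian_iterate R m M T (fun i => (z i%:Z, z (i%:Z + 1))) n;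
  last by [].
move=> i i_n; have [TE dT _] := T_branch i i_n; split; last exact: dT.
rewrite TE; have -> : i.+1%:Z = i%:Z + 1 by lia.
by have -> : i%:Z + 1 + 1 = i%:Z + 2 by lia.
Qed.

(** An eigenvector of D(T^n) gives a nonzero isotropic vector of h. *)
Lemma multiplier_kernel (n : nat) (z : int -> M) (T : nat -> M * M -> M * M)
    (lambda : C) :
  (0 < n)%N -> (forall i : int, z (i + n%:Z) = z i) ->
  (forall i : nat, (1 <= i <= n)%N ->
    lagrangian_map_near L (T i) (z i%:Z, z (i%:Z + 1)) (z (i%:Z + 1), z (i%:Z + 2))) ->
  lambda != 0 ->
  eigenvalue (complexify (mjacobian (iterate T n) (z 1, z 2))) lambda ->
  exists u, [/\ quasi_periodic n lambda u, exists j, u j != 0 & hform L n z u u = 0].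
Proof.
move=> n0 z_per T_branch lambda0.
rewrite (mjacobian_return T_branch) => /eigenvalueP[v v_eigen v0].
pose J (i : nat) := mjacobian (T i) (z i%:Z, z (i%:Z + 1)).
pose U (i : nat) := v *m complexify (mxprods J i).
have U0 : U 0%N = v by rewrite /U /mxprods /= /complexify map_mx1 mulmx1.
have US i : U i.+1 = U i *m complexify (J i.+1) by rewrite /U -mulmxA -complexifyM.
have Un : U n = lambda *: U 0%N by rewrite U0 /U v_eigen.
have Ush i : (i < n)%N -> lsubmx (U i.+1) = rsubmx (U i).
  move=> i_n; rewrite US; apply: complexify_lsubmx => w.
  exact: (lsubmx_mjacobian L_smooth (T_branch i.+1 i_n)).
pose u := extension n lambda U.
have uq : quasi_periodic n lambda u by exact: extension_quasi_periodic.
have EL (i : nat) : (1 <= i <= n)%N -> euler_lagrange L z u (i%:Z + 1) = 0.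
  move=> i_n; apply: (branch_euler_lagrange (T_branch i i_n)).
  have -> : edge u i%:Z = U i.-1 by apply: edge_extension => //; lia.
  have -> : edge u (i%:Z + 1) = U i.
    have -> : i%:Z + 1 = i.+1%:Z by lia.
    by rewrite [LHS]edge_extension //; lia.
  by case: i i_n => // i _; exact: esym (US i).
exists u; split=> //.
  by apply: extension_neq0; rewrite ?U0.
apply: hform_euler_lagrange => j jn; have [j1|j1] := eqVneq j 1%N; last first.
  have -> : j%:Z = j.-1%:Z + 1 by lia.
  by apply: EL; lia.
(* EL reaches the vertices 2, ..., n + 1; the vertex n + 1 stands for 1 *)
have := EL n; rewrite n0 leqnn => /(_ isT).
have -> : n%:Z + 1 = 1 + n%:Z by lia.
rewrite (euler_lagrange_quasi_periodic _ z_per _ uq) j1.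
by move/eqP; rewrite scaler_eq0 (negbTE lambda0) => /eqP.
Qed.

Lemma posdef_hyperbolic (n : nat) (z : int -> M) :
  (0 < n)%N -> (forall i : int, z (i + n%:Z) = z i) ->
  (forall rho : C, `|rho| = 1 -> hform_posdef L n z rho) ->
  hyperbolic L n z.
Proof.
move=> n0 z_per pos T T_branch lambda eig; apply/negP => /eqP lambda1.
have lambda0 : lambda != 0 by rewrite -normr_gt0 lambda1.
have [u [uq u0 hu]] := multiplier_kernel n0 z_per T_branch lambda0 eig.
by have := pos _ lambda1 _ uq u0; rewrite hu ltxx.
Qed.

End Multipliers.

Theorem proposition4p5 (R : realType) (m : nat) (M : smoothManifold R m)
    (L : M -> M -> R)
    (L_smooth : smooth_lagrangian L)
    (L_reversible : forall x y : M, L x y = L y x)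
    (k : nat) (hk : (1 < k)%N) (xs : 'I_k -> M)
    (B_nondeg : nondegenerate_near L (reversible_seq hk xs))
    (x_traj : periodic_trajectory L (2 * k - 2) (reversible_seq hk xs))
    (x_min : nondegenerate_min (action_plus L hk) xs) :
  (forall rho : R[i], `|rho| = 1 ->
     hform_posdef L (2 * k - 2) (reversible_seq hk xs) rho) /\
  hyperbolic L (2 * k - 2) (reversible_seq hk xs).
Proof.
have [z_per _] := x_traj.
have pos (rho : R[i]) :
    `|rho| = 1 -> hform_posdef L (2 * k - 2) (reversible_seq hk xs) rho.
  exact: hform_reversible_posdef.
by split=> //; apply: posdef_hyperbolic => //; lia.
Qed.
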